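(* Let $k$ be a field of characteristic zero, let $n\geq 4$, and let $R=k[x_1,\ldots,x_n]$ be the standard graded polynomial ring. Write $w=x_{n-1}$ and $u=x_n$. Let $$f=2w^{n-1}u+\sum_{i=1}^{n-2}x_i\,w^{i-1}u^{n-i}\in R.$$ Then $f$ is a linear free divisor.
   Context: Let $R=k[x_1,\ldots,x_n]$ be standard graded over a field $k$ of characteristic zero, with homogeneous maximal ideal $R_+=(x_1,\ldots,x_n)$. Polynomials $f$ to which the terms below apply are non-zero, homogeneous, reduced (a product of distinct irreducible factors), lie in $R_+^2$, and have $k$-linearly independent partial derivatives (standing convention). The Jacobian ideal is $J_f=(f_{x_1},\ldots,f_{x_n})\subset R$, $f_{x_i}=\partial f/\partial x_i$. $T_{R/k}(f)$ is the $R$-module of logarithmic derivations of $f$, i.e. derivations $\theta=\sum_i g_i\,\partial/\partial x_i$ ($g_i\in R$) with $\theta(f)\in (f)$. The polynomial $f$ is a free divisor if $T_{R/k}(f)$ is a free $R$-module. It is a linear free divisor if it is a free divisor and $J_f$ is linearly presented, i.e. $J_f$ has a minimal graded free resolution of the form $0\to R(-n)^{n-1}\to R(-n+1)^n\to J_f\to 0$. *)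

(* Defs.v *)
From HB Require Import structures.
From mathcomp Require Import all_boot all_order all_algebra.
From mathcomp Require Export mpoly.

Set Implicit Arguments.
Unset Strict Implicit.
Unset Printing Implicit Defensive.

Import GRing.Theory.
Local Open Scope ring_scope.

Definition ideal_gen (R : comNzRingType) (I : finType) (g : I -> R) (p : R) : Prop :=
  exists c : I -> R, p = \sum_i c i * g i.

(* For rank reasons every basis of a submodule of a finite free module over a
   domain is finite, so finite index sets are enough here. *)
Definition free_submodule (R : nzRingType) (M : lmodType R) (N : M -> Prop) : Prop :=
  exists (m : nat) (b : 'I_m -> M),
    (forall i, N (b i)) /\
    (forall v, N v -> exists! c : 'rV[R]_m, v = \sum_i c 0 i *: b i).

Definition irreducible_elt (R : idomainType) (p : R) : Prop :=
  [/\ p != 0, p \isn't a GRing.unit &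
      forall a b : R, p = a * b -> a \is a GRing.unit \/ b \is a GRing.unit].

Definition associates (R : idomainType) (p q : R) : Prop :=
  exists2 c : R, c \is a GRing.unit & p = c * q.

Definition reduced_elt (R : idomainType) (f : R) : Prop :=
  exists (m : nat) (p : 'I_m -> R),
    [/\ forall i, irreducible_elt (p i),
        forall i j, i != j -> ~ associates (p i) (p j) &
        f = \prod_i p i].

Section LinearFreeDivisors.
Variables (k : fieldType) (n : nat).
Local Notation R := {mpoly k[n]}.

Definition irrelevant_ideal : R -> Prop := ideal_gen (fun i : 'I_n => 'X_i : R).

Definition irrelevant_ideal_sq : R -> Prop :=
  ideal_gen (fun ij : 'I_n * 'I_n => 'X_(ij.1) * 'X_(ij.2) : R).

Definition jacobian_ideal (f : R) : R -> Prop :=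
  ideal_gen (fun i : 'I_n => f^`M(i)).

Definition partials_independent (f : R) : Prop :=
  forall c : 'I_n -> k, \sum_i c i *: f^`M(i) = 0 -> forall i, c i = 0.

Definition admissible (f : R) : Prop :=
  [/\ f != 0,
      exists d : nat, f \is d.-homog,
      reduced_elt f,
      irrelevant_ideal_sq f &
      partials_independent f].

(* The row vector g encodes the derivation with coefficients g 0 i, that is,
   the one sending 'X_i to g 0 i. *)
Definition derivation_of (g : 'rV[R]_n) (p : R) : R :=
  \sum_i g 0 i * p^`M(i).

Definition log_derivation (f : R) (g : 'rV[R]_n) : Prop :=
  exists h : R, derivation_of g f = h * f.

Definition free_divisor (f : R) : Prop :=
  admissible f /\ free_submodule (log_derivation f).

(* A is the matrix, acting on row vectors from the right, of a degree 0
   homomorphism R(-a)^p -> R(-b)^q; 0 belongs to every d.-homog. *)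
Definition graded_map (a b p q : nat) (A : 'M[R]_(p, q)) : Prop :=
  forall i j, if (b <= a)%N then A i j \is (a - b).-homog else A i j == 0.

(* J has a minimal graded free resolution of the form
   0 -> R(-a)^p --A--> R(-b)^q --B--> J -> 0. *)
Definition min_graded_resolution (a p b q : nat) (J : R -> Prop) : Prop :=
  exists (A : 'M[R]_(p, q)) (B : 'cV[R]_q),
    graded_map a b A /\ graded_map b 0 B /\
    (forall x : R, J x <-> exists v : 'rV[R]_q, v *m B = x%:M) /\
    (forall v : 'rV[R]_q, v *m B = 0 <-> exists w : 'rV[R]_p, v = w *m A) /\
    (forall w : 'rV[R]_p, w *m A = 0 -> w = 0) /\
    (forall i j, irrelevant_ideal (A i j)).

Definition linearly_presented (J : R -> Prop) : Prop :=
  min_graded_resolution n n.-1 n.-1 n J.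

Definition linear_free_divisor (f : R) : Prop :=
  free_divisor f /\ linearly_presented (jacobian_ideal f).

End LinearFreeDivisors.

(* Main.v *)
Require Import Defs.
From HB Require Import structures.
From mathcomp Require Import all_boot all_order all_algebra.
From mathcomp Require Import ring.

Set Implicit Arguments.
Unset Strict Implicit.
Unset Printing Implicit Defensive.

Import GRing.Theory.
Local Open Scope ring_scope.

(** The proof rests on one observation: in the order of the variables, the
    partial derivatives of [f] have strictly decreasing [u]-adic valuations
    [n - 1, n - 2, ..., 1, 0].  Indeed the derivative in [x_i] is the monomial
    [w ^ i * u ^ (n - 1 - i)], the derivative in [w] is divisible by [u]
    exactly once, and the one in [u] is not divisible by [u].

    Consequently, in a syzygy whose last non-zero coefficient sits at position
    [q], that coefficient is divisible by the prime [u].  There are [n - 1]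
    linear syzygies, the rows of [syzygy_mx], ending at the positions
    [1, ..., n - 1] with last coefficient [u] up to a unit:
    - [w d_i - u d_(i+1)] between consecutive monomials,
    - one expressing [u * f_w] through the monomials,
    - one expressing [(n - 1) * u * f_u - w * f_w] through the monomials.
    Clearing the last coefficient again and again writes every syzygy in terms
    of these rows ([staircase_exact]), and the echelon shape makes the rows
    independent ([staircase_inj]).  This is the linear resolution of the
    Jacobian ideal.

    Freeness of the logarithmic derivations follows: by Euler's identity and
    characteristic zero, a derivation sending [f] to [h * f] differs from
    [h / n] times the Euler derivation by a syzygy of the partials, so the
    Euler derivation and the rows of [syzygy_mx] form a basis
    ([log_derivation_free]).  The partials are linearly independent over [k]
    because every entry of a syzygy vanishes at the origin.

    Finally [f = u * g] is reduced: [g] has degree one in [x_0], with leading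
    coefficient a power of [u] and [u] does not divide [g], so [g] is
    irreducible and not associated to [u]. *)

Definition divides (R : comNzRingType) (u a : R) : Prop := exists q, a = u * q.

(** * Syzygies of a sequence with strictly decreasing valuations *)

Section Staircase.
Variables (R : idomainType) (u : R).
Hypothesis u_neq0 : u != 0.
Hypothesis u_prime :
  forall a b, divides u (a * b) -> divides u a \/ divides u b.

Variables (m : nat) (A : 'M[R]_(m, m.+1)) (B : 'cV[R]_m.+1) (c : 'I_m.+1 -> R).
Hypothesis B_val : forall i, B i 0 = u ^+ (m - i) * c i.
Hypothesis c_nu : forall i, ~ divides u (c i).
Hypothesis AB0 : A *m B = 0.
Hypothesis A_hess : forall (p : 'I_m) (q : 'I_m.+1), (p.+1 < q)%N -> A p q = 0.
Hypothesis A_diag :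
  forall p, exists2 e, e \is a GRing.unit & A p (lift ord0 p) = e * u.

(** Every entry of [B] before position [q] carries at least one more factor
    [u] than [u ^ (m - q)]; after cancelling [u ^ (m - q)] the relation says that [u]
    divides the product of the last coefficient with [c q]. *)
Lemma divides_top_coef (v : 'rV[R]_m.+1) (q : 'I_m.+1) :
  (forall i : 'I_m.+1, (q < i)%N -> v 0 i = 0) -> v *m B = 0 ->
  divides u (v 0 q).
Proof.
move=> v0 vB0.
suff: divides u (v 0 q * c q) by case/u_prime => // /c_nu.
have := congr1 (fun M : 'M_1 => M 0 0) vB0.
rewrite !mxE (bigD1 q) //= B_val.
set S := \sum_(i < m.+1 | (i < q)%N) v 0 i * (u ^+ (q - i).-1 * c i).
have -> : \sum_(i < m.+1 | i != q) v 0 i * B i 0 = u ^+ (m - q) * (u * S).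
  rewrite !mulr_sumr [RHS]big_mkcond [LHS]big_mkcond; apply: eq_bigr => i _.
  case: (ltngtP i q) => iq.
  - have -> : i != q by rewrite neq_ltn iq.
    have mi : ((m - i) = (m - q) + (q - i).-1.+1)%N.
      rewrite prednK ?subn_gt0 // addnBA ?subnK // ?[(i <= q)%N]ltnW //.
      by rewrite -ltnS.
    rewrite B_val mi exprD exprS -!mulrA mulrCA; congr (_ * _).
    by rewrite mulrCA.
  - by rewrite v0 // mul0r if_same.
  - by rewrite (val_inj iq) eqxx.
rewrite mulrCA -mulrDr => /eqP; rewrite mulf_eq0 expf_eq0 (negPf u_neq0) andbF.
by rewrite orFb addr_eq0 => /eqP ->; exists (- S); rewrite mulrN.
Qed.

(** Induction on the last position [q] where the syzygy may be non-zero: row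
    [q - 1] of [A] ends there with a unit times [u], so a multiple of it
    clears the coefficient, which is divisible by [u]. *)
Lemma staircase_exact (v : 'rV[R]_m.+1) :
  v *m B = 0 <-> exists w, v = w *m A.
Proof.
split; last by case=> w ->; rewrite -mulmxA AB0 mulmx0.
suff H q : (q < m.+1)%N -> forall v' : 'rV[R]_m.+1,
    (forall i : 'I_m.+1, (q < i)%N -> v' 0 i = 0) -> v' *m B = 0 ->
    exists w, v' = w *m A.
  by apply: (H m) => // i; rewrite ltnNge -ltnS ltn_ord.
elim: q => [|q IHq] ltq {}v v0 vB.
  (* A syzygy of the single non-zero element [B 0 0] is trivial. *)
  exists 0; rewrite mul0mx; apply/rowP=> i; rewrite mxE.
  have [i0|/v0//] := posnP i.
  have {i0} -> : i = ord0 by apply: val_inj.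
  move: (congr1 (fun M : 'M_1 => M 0 0) vB).
  rewrite !mxE big_ord_recl big1 => [|j _]; last by rewrite v0 // mul0r.
  rewrite addr0 B_val => /eqP.
  rewrite !mulf_eq0 expf_eq0 (negPf u_neq0) andbF /=.
  case/orP=> /eqP // c0.
  by case: (@c_nu ord0); exists 0; rewrite c0 mulr0.
have [t vt] := @divides_top_coef v (Ordinal ltq) v0 vB.
have ltq' : (q < m)%N by [].
have [e eU Ae] := A_diag (Ordinal ltq').
pose v' := v - (t / e) *: row (Ordinal ltq') A.
case: (IHq (ltnW ltq) v').
- move=> i; rewrite leq_eqVlt => /predU1P[iE|lti]; rewrite !mxE.
    have -> : i = lift ord0 (Ordinal ltq') by apply: val_inj; rewrite /= -iE.
    rewrite Ae mulrA divrK // mulrC.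
    have -> : lift ord0 (Ordinal ltq') = Ordinal ltq by apply: val_inj.
    by rewrite vt mulrC subrr.
  by rewrite v0 // A_hess // mulr0 subrr.
- by rewrite mulmxBl vB -scalemxAl -row_mul AB0 row0 scaler0 subrr.
move=> w vw; exists (w + (t / e) *: delta_mx 0 (Ordinal ltq')).
by rewrite mulmxDl -vw -scalemxAl -rowE subrK.
Qed.

Lemma staircase_inj (w : 'rV[R]_m) : w *m A = 0 -> w = 0.
Proof.
move=> wA; apply/rowP => p0; rewrite mxE; apply/eqP/negPn/negP => wp0.
(* At the last non-zero entry [p] of [w], column [p + 1] of [w *m A] reduces
   to that entry times the superdiagonal one. *)
case: (@arg_maxnP _ p0 (fun p => w 0 p != 0) (fun p => p : nat) wp0).
move=> p wp pmax.
have := congr1 (fun M : 'rV_m.+1 => M 0 (lift ord0 p)) wA.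
rewrite !mxE (bigD1 p) //= big1 => [/eqP|i ip].
  have [e eU ->] := A_diag p.
  rewrite addr0 !mulf_eq0 (negPf u_neq0) (negPf wp) orbF /=.
  by move=> /eqP e0; rewrite e0 unitr0 in eU.
have [w0|/pmax] := eqVneq (w 0 i) 0; first by rewrite w0 mul0r.
rewrite /= leq_eqVlt (negPf (_ : i != p :> nat)) //= => lt.
by rewrite A_hess ?mulr0 // lift0.
Qed.

End Staircase.

(** * Euler's identity and irreducibility of linear polynomials *)

Lemma mpoly_rmorph_ext (n : nat) (R : comNzRingType) (S : comNzRingType)
    (f g : {rmorphism {mpoly R[n]} -> S}) :
  (forall c, f c%:MP = g c%:MP) -> (forall i, f 'X_i = g 'X_i) -> f =1 g.
Proof.
move=> fgC fgX p; rewrite [p]mpolyE !raddf_sum; apply: eq_bigr => m _.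
rewrite -mul_mpolyC /= !rmorphM fgC; congr (_ * _).
rewrite mpolyXE_id !rmorph_prod; apply: eq_bigr => i _.
by rewrite !rmorphXn /= fgX.
Qed.

Lemma euler_identity (n : nat) (R : comNzRingType) d (p : {mpoly R[n]}) :
  p \is d.-homog -> \sum_i 'X_i * p^`M(i) = d%:R * p.
Proof.
move=> /dhomogP hp.
rewrite [p in RHS]mpolyE mulr_sumr.
transitivity (\sum_i \sum_(m <- msupp p) 'X_i * (p@_m *: 'X_[m])^`M(i)).
  apply: eq_bigr => i _; rewrite {1}[p]mpolyE.
  by rewrite (raddf_sum (mderiv i)) mulr_sumr.
rewrite exchange_big /=; apply: eq_big_seq => m /hp md.
transitivity (\sum_(i < n) (m i)%:R * (p@_m *: 'X_[m])).
  apply: eq_bigr => i _; rewrite mderivZ mderivX.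
  have [->|mi] := eqVneq (m i) 0%N.
    by rewrite scale0r scaler0 mulr0 mul0r.
  rewrite -!scalerAr scalerA -mpolyXD addmC submK ?lep1mP //.
  by rewrite mulrC -scalerA scaler_nat mulr_natl scalerMnr.
by rewrite -mulr_suml -natr_sum -mdegE -md.
Qed.

Lemma coef_linear (S : nzRingType) (a b : S) :
  (a%:P * 'X + b%:P)`_1 = a /\ (a%:P * 'X + b%:P)`_0 = b.
Proof. by rewrite !coefD !coefMX !coefC addr0 add0r. Qed.

(** When a polynomial of degree one in [x] is a product of two, one of them has
    degree zero in [x] and then divides both coefficients.  The morphism [phi] provides the degree:
    it rewrites elements of [R] as polynomials in [x]. *)
Lemma irreducible_linear (R : idomainType) (x : R)
    (phi : {rmorphism R -> {poly R}}) (a b : R) :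
  (forall p, (phi p).[x] = p) ->
  phi x = 'X -> phi a = a%:P -> phi b = b%:P -> a != 0 ->
  (forall c, divides c a -> divides c b -> c \is a GRing.unit) ->
  irreducible_elt (a * x + b).
Proof.
move=> phiK phix phia phib a0 cop.
have E : phi (a * x + b) = a%:P * 'X + b%:P.
  by rewrite rmorphD rmorphM phix phia phib.
have sz : size (phi (a * x + b)) = 2%N.
  by rewrite E size_MXaddC size_polyC a0 polyC_eq0 (negPf a0).
have phi_gt0 p : p != 0 -> (0 < size (phi p))%N.
  rewrite size_poly_gt0; apply: contraNneq => p0.
  by rewrite -(phiK p) p0 horner0.
have size_phiM p q : p * q != 0 ->
    size (phi (p * q)) = (size (phi p) + size (phi q)).-1.
  rewrite mulf_eq0 negb_or rmorphM => /andP[p0 q0].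
  by rewrite size_mul -?size_poly_gt0 ?phi_gt0.
have nz : a * x + b != 0.
  by apply/eqP=> E0; rewrite E0 rmorph0 size_poly0 in sz.
have unit_of_size1 p q : a * x + b = p * q -> size (phi p) = 1%N ->
    p \is a GRing.unit.
  move=> pq /eqP /size_poly1P[c _ pc].
  have cp : c = p by have := phiK p; rewrite pc hornerC.
  have E1 j : (p%:P * phi q)`_j = (a%:P * 'X + b%:P)`_j.
    by rewrite -E pq rmorphM pc cp.
  apply: cop; [exists (phi q)`_1 | exists (phi q)`_0].
    by have := E1 1%N; rewrite coefCM (coef_linear a b).1 => ->.
  by have := E1 0%N; rewrite coefCM (coef_linear a b).2 => ->.
split=> //.
  apply/negP=> /unitrPr[q pq].
  have := size_phiM (a * x + b) q; rewrite pq rmorph1 size_poly1 sz oner_eq0.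
  have q0 : q != 0.
    by apply: contra_eqN pq => /eqP ->; rewrite mulr0 eq_sym oner_eq0.
  by move=> /(_ isT); move: (phi_gt0 _ q0); case: (size _).
move=> p q pq; have := size_phiM p q; rewrite -pq sz => /(_ nz).
have /andP[p0 q0] : (p != 0) && (q != 0) by rewrite -negb_or -mulf_eq0 -pq.
move: (phi_gt0 _ p0) (phi_gt0 _ q0) (unit_of_size1 p q pq) (unit_of_size1 q p).
rewrite [q * p]mulrC -pq => + + + /(_ erefl).
case: (size (phi p)) => [|[|s]] //; first by move=> _ _ /(_ erefl); left.
case: (size (phi q)) => [|[|t]] //; first by move=> _ _ _ /(_ erefl); right.
by rewrite !addSn !addnS => _ _ _ _ [].
Qed.

(** * A variable as a prime element *)

Section SetZero.
Variables (k : fieldType) (n : nat).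
Local Notation R := {mpoly k[n]}.

Definition kill_var (i : 'I_n) : {rmorphism R -> R} :=
  comp_mpoly [tuple if j == i then 0 else 'X_j | j < n].

Lemma kill_varX i j : kill_var i 'X_j = if j == i then 0 else 'X_j.
Proof. by rewrite /= comp_mpolyXU -tnth_nth tnth_mktuple. Qed.

Lemma kill_varC i c : kill_var i c%:MP = c%:MP.
Proof. exact: comp_mpolyC. Qed.

(** The elements congruent to their image modulo ['X_i] are closed under sums
    and products, and contain the constants and the variables. *)
Lemma kill_var_dvd i p : divides 'X_i (p - kill_var i p).
Proof.
have H0 : divides 'X_i (0 - kill_var i 0).
  by exists 0; rewrite rmorph0 subr0 mulr0.
have HM (a b : R) : divides 'X_i (a - kill_var i a) ->
    divides 'X_i (b - kill_var i b) ->
    divides 'X_i (a * b - kill_var i (a * b)).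
  move=> [q aq] [r br]; exists (q * b + kill_var i a * r).
  rewrite mulrDr mulrA -aq mulrCA -br rmorphM mulrBl mulrBr addrA.
  by rewrite subrK.
have H1 (a : R) : kill_var i a = a -> divides 'X_i (a - kill_var i a).
  by move=> ->; exists 0; rewrite subrr mulr0.
elim/mpolyind: p => [//|c m p _ _ [q pq]].
have [r mr] : divides 'X_i (c *: 'X_[m] - kill_var i (c *: 'X_[m])).
  rewrite -mul_mpolyC; apply: (HM); first by apply/H1/kill_varC.
  rewrite (mpolyXE_id _ m).
  apply: (big_ind (fun a => divides 'X_i (a - kill_var i a))) => [|//|j _].
    by apply: H1; rewrite rmorph1.
  elim: (m j) => [|e IHe]; first by apply: H1; rewrite rmorph1.
  rewrite exprS; apply: (HM) => //; have [->|ji] := eqVneq j i.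
    by exists 1; rewrite kill_varX eqxx subr0 mulr1.
  by apply: H1; rewrite kill_varX (negPf ji).
by exists (r + q); rewrite rmorphD opprD addrACA pq mr mulrDr.
Qed.

Lemma kill_var_eq0 i p : kill_var i p = 0 <-> divides 'X_i p.
Proof.
split=> [p0|[q ->]]; first by have := kill_var_dvd i p; rewrite p0 subr0.
by rewrite rmorphM kill_varX eqxx mul0r.
Qed.

Lemma var_prime (i : 'I_n) (a b : R) :
  divides 'X_i (a * b) -> divides 'X_i a \/ divides 'X_i b.
Proof.
move/kill_var_eq0/eqP; rewrite rmorphM mulf_eq0.
by case/orP=> /eqP /kill_var_eq0; [left|right].
Qed.

Lemma var_neq0 (i : 'I_n) : 'X_i != 0 :> R.
Proof.
apply/eqP=> /(congr1 (mcoeff U_(i))); rewrite mcoeffXU eqxx mcoeff0 => /eqP.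
by rewrite oner_eq0.
Qed.

Lemma dvd_var_exp (i : 'I_n) (c : R) m :
  divides c ('X_i ^+ m) -> c \is a GRing.unit \/ divides 'X_i c.
Proof.
elim: m => [|m IHm] [q]; rewrite ?expr0 ?exprS => E.
  by left; apply/unitrPr; exists q.
have /var_prime[|[r qr]] : divides 'X_i (c * q) by exists ('X_i ^+ m).
  by right.
apply: IHm; exists r; apply: (mulfI (var_neq0 i)).
by rewrite E qr mulrCA.
Qed.

(** Polynomials in ['X_i]; the coefficients are kept in the full polynomial
    ring, where ['X_i] happens not to occur, so that evaluation at ['X_i] is a
    left inverse. *)
Definition as_upoly (i : 'I_n) : {rmorphism R -> {poly R}} :=
  mmap (polyC \o @mpolyC n k) (fun j => if j == i then 'X else ('X_j)%:P).

Lemma as_upolyX i j : as_upoly i 'X_j = if j == i then 'X else ('X_j)%:P.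
Proof. by rewrite /= mmapX mmap1U. Qed.

Lemma as_upolyC i c : as_upoly i c%:MP = c%:MP%:P.
Proof. by rewrite /= mmapC. Qed.

Lemma as_upolyK i p : (as_upoly i p).['X_i] = p.
Proof.
apply: (@mpoly_rmorph_ext _ _ _ (horner_eval 'X_i \o as_upoly i) idfun)
  => [c|j].
  by rewrite /= /horner_eval as_upolyC hornerC.
rewrite /= /horner_eval as_upolyX.
case: eqP => [->|_]; first by rewrite hornerX.
by rewrite hornerC.
Qed.

Lemma as_upoly_kill i p : kill_var i p = p -> as_upoly i p = p%:P.
Proof.
move=> pE.
pose F : {rmorphism R -> {poly R}} := as_upoly i \o kill_var i.
pose G : {rmorphism R -> {poly R}} := polyC \o kill_var i.
have FG : F =1 G.
  apply: (@mpoly_rmorph_ext _ _ _ F G) => [c|j].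
    change (as_upoly i (kill_var i c%:MP) = (kill_var i c%:MP)%:P).
    by rewrite kill_varC as_upolyC.
  change (as_upoly i (kill_var i 'X_j) = (kill_var i 'X_j)%:P).
  rewrite kill_varX; case: ifP => ji; first by rewrite !rmorph0.
  by rewrite as_upolyX ji.
by have : as_upoly i (kill_var i p) = (kill_var i p)%:P := FG p; rewrite pE.
Qed.

Lemma irreducible_linear_var i (a b : R) :
  a != 0 -> kill_var i a = a -> kill_var i b = b ->
  (forall c, divides c a -> divides c b -> c \is a GRing.unit) ->
  irreducible_elt (a * 'X_i + b).
Proof.
move=> a0 aE bE; apply: (@irreducible_linear _ _ (as_upoly i)) => //.
- exact: as_upolyK.
- by rewrite as_upolyX eqxx.
- exact: as_upoly_kill.
- exact: as_upoly_kill.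
Qed.

End SetZero.

Arguments kill_var {k n} i.

(** * The polynomial, its partials and its linear syzygies *)

(** The identities hold for any elements [x 0, x 1, ...] of a commutative ring;
    the variables are [x 0, ..., x m], then [w] and [u], so that the number of
    variables is [m + 3]. *)
Section Equation.
Variables (R : comNzRingType) (m : nat) (x : nat -> R).
Local Notation w := (x m.+1).
Local Notation u := (x m.+2).

Definition residual : R :=
  w ^+ m.+2 *+ 2 + \sum_(i < m.+1) x i * w ^+ i * u ^+ (m.+1 - i).

(** The partial derivative at position [q] without its factor
    [u ^ (m + 2 - q)]; for the variables of a polynomial ring over a field of
    characteristic zero, [u] does not divide it ([partial_unit_partP]). *)
Definition partial_unit_part (q : nat) : R :=
  if (q <= m)%N then w ^+ q
  else if q == m.+1 then
    w ^+ m.+1 *+ (2 * m.+2)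
    + \sum_(i < m.+1) x i * w ^+ i.-1 * u ^+ (m.+1 - i) *+ i
  else
    w ^+ m.+2 *+ 2
    + \sum_(i < m.+1) x i * w ^+ i * u ^+ (m.+1 - i) *+ (m.+2 - i).

Definition partial (q : nat) : R := u ^+ (m.+2 - q) * partial_unit_part q.

(** The rows [p < m] relate consecutive monomials; row [m] expands [u * f_w]
    and row [m + 1] expands [w * f_w - (m + 2) * u * f_u], a combination in
    which the monomial [w ^ (m + 2) * u] cancels. *)
Definition syzygy (p q : nat) : R :=
  if (p < m)%N then w *+ (q == p) - u *+ (q == p.+1)
  else if p == m then
    if (q < m)%N then - (x q.+1 *+ q.+1)
    else if q == m then - (w *+ (2 * m.+2)) else u *+ (q == m.+1)
  else
    if (q <= m)%N then x q *+ (m.+2 * (m.+2 - q)) - x q *+ q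
    else if q == m.+1 then w else - (u *+ m.+2).

Definition freepoly : R :=
  w ^+ m.+2 * u *+ 2 + \sum_(i < m.+1) x i * w ^+ i * u ^+ (m.+2 - i).

Lemma freepoly_factor : freepoly = u * residual.
Proof.
rewrite /freepoly /residual mulrDr mulr_sumr; congr (_ + _); first by ring.
apply: eq_bigr => i _; have im : (i <= m)%N by rewrite -ltnS.
by rewrite subSn ?leqW // exprS; ring.
Qed.

Lemma residual_linear :
  residual = u ^+ m.+1 * x 0 +
    (w ^+ m.+2 *+ 2 + \sum_(i < m) x i.+1 * w ^+ i.+1 * u ^+ (m - i)).
Proof.
rewrite /residual big_ord_recl subn0; set S := \sum_(i < m) _.
rewrite (_ : S = \sum_(i < m) x i.+1 * w ^+ i.+1 * u ^+ (m - i)); first by ring.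
by apply: eq_bigr => i _.
Qed.

Lemma sum_delta n (F : nat -> R) (a : R) p : (p < n)%N ->
  \sum_(q < n) (a *+ (q == p :> nat)) * F q = a * F p.
Proof.
move=> lpn; rewrite (bigD1 (Ordinal lpn)) //= eqxx mulr1n.
rewrite big1 ?addr0 // => i ip.
by rewrite (_ : (i == p :> nat) = false) ?mul0r //; apply: negbTE.
Qed.

Lemma partial_low q : (q <= m)%N -> partial q = u ^+ (m.+1 - q) * w ^+ q * u.
Proof.
by move=> qm; rewrite /partial /partial_unit_part qm subSn ?leqW // exprS; ring.
Qed.

Lemma partial_w : partial m.+1 = 
  u * (w ^+ m.+1 *+ (2 * m.+2)
    + \sum_(i < m.+1) x i * w ^+ i.-1 * u ^+ (m.+1 - i) *+ i).
Proof. by rewrite /partial /partial_unit_part ltnn eqxx subSnn. Qed.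

Lemma partial_u : partial m.+2 = 
    w ^+ m.+2 *+ 2
    + \sum_(i < m.+1) x i * w ^+ i * u ^+ (m.+1 - i) *+ (m.+2 - i).
Proof.
by rewrite /partial /partial_unit_part ltnNge leqW //= gtn_eqF // subnn mul1r.
Qed.

Lemma syzygy_partial p : (p < m.+2)%N ->
  \sum_(q < m.+3) syzygy p q * partial q = 0.
Proof.
rewrite !ltnS leq_eqVlt ltnS leq_eqVlt orbA orbC.
rewrite [(p == m.+1) || _]orbC => /or3P[lpm|/eqP->|/eqP->].
- under eq_bigr => q _ do rewrite /syzygy lpm mulrBl.
  rewrite sumrB !sum_delta ?ltnS ?(leq_trans (ltnW lpm)) ?leqW ?leqnSn //.
  rewrite !partial_low ?[(p <= m)%N]ltnW // subSn ?[(p <= m)%N]ltnW // subSS.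
  by rewrite !exprS; ring.
- have sm q : (q < m)%N -> syzygy m q = - (x q.+1 *+ q.+1).
    by rewrite /syzygy ltnn eqxx => ->.
  rewrite 3!big_ord_recr /=.
  rewrite (_ : syzygy m m = - (w *+ (2 * m.+2))); last first.
    by rewrite /syzygy !ltnn !eqxx.
  rewrite (_ : syzygy m m.+1 = u); last first.
    by rewrite /syzygy ltnn eqxx ltnNge leqnSn gtn_eqF // eqxx.
  rewrite (_ : syzygy m m.+2 = 0); last first.
    by rewrite /syzygy ltnn eqxx ltnNge leqW // !gtn_eqF // -?addn1 ?leq_addr.
  (* The term [i = 0] of the derivative in [w] vanishes; the others are shifted
     by one to meet the entries [x q.+1]. *)
  rewrite mul0r addr0 partial_w partial_low // subSnn big_ord_recl mulr0n add0r.
  set S := \sum_(i < m) _ *+ _.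
  rewrite (_ : \sum_(i < m) _ = - (u * u * S)); first by rewrite !exprS; ring.
  rewrite mulr_sumr -sumrN; apply: eq_bigr => i _.
  have im : (i <= m)%N by apply: ltnW.
  by rewrite sm // partial_low // lift0 subSS subSn // exprS; ring.
have ltm : (m.+1 < m)%N = false by rewrite ltnNge leqnSn.
have eqm : (m.+1 == m) = false by rewrite gtn_eqF.
have sm q : (q <= m)%N ->
    syzygy m.+1 q = x q *+ (m.+2 * (m.+2 - q)) - x q *+ q.
  by rewrite /syzygy ltm eqm => ->.
rewrite 2!big_ord_recr /= (_ : syzygy m.+1 m.+1 = w); last first.
  by rewrite /syzygy ltm eqm ltnn eqxx.
rewrite (_ : syzygy m.+1 m.+2 = - (u *+ m.+2)); last first.
  by rewrite /syzygy ltm eqm gtn_eqF.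
rewrite partial_w partial_u.
set S := \sum_(i < m.+1) _ *+ i; set T := \sum_(i < m.+1) _ *+ (_ - _).
rewrite (_ : \sum_(i < m.+1) _ = T * (u *+ m.+2) - w * (u * S)).
  by rewrite !exprS; ring.
rewrite mulr_suml !mulr_sumr -sumrB; apply: eq_bigr => i _.
have im : (i <= m)%N by rewrite -ltnS.
rewrite sm // partial_low //.
case: (val i) => [|j] /=; rewrite ?mulr0n ?subr0; first by ring.
by rewrite exprS; ring.
Qed.
End Equation.

(** * Homogeneous polynomials in characteristic zero *)

Section Homog.
Variables (k : fieldType) (n : nat).
Hypothesis hk : [pchar k] =i pred0.
Local Notation R := {mpoly k[n]}.

Lemma natr_mpoly_unit (d : nat) : d.+1%:R \is a @GRing.unit R.
Proof.
rewrite -(rmorph_nat (@mpolyC n k)) rmorph_unit // unitfE.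
by rewrite ((pcharf0P k).1 hk).
Qed.

Lemma mderiv_homog (d : nat) (p : R) i :
  p \is d.+1.-homog -> p^`M(i) \is d.-homog.
Proof.
move=> /dhomogP hp; rewrite [p]mpolyE raddf_sum /=.
rewrite big_seq; apply: rpred_sum => m /hp md; rewrite linearZ /=.
apply: rpredZ; rewrite mderivX.
have [->|mi] := eqVneq (m i) 0%N; first by rewrite scale0r rpred0.
apply: rpredZ; rewrite dhomogX /=.
have : mdeg (m - U_(i) + U_(i))%MM = d.+1 by rewrite submK ?lep1mP.
by rewrite mdegD mdeg1 addn1 => -[->].
Qed.

Lemma mderiv_exp (p : R) e i : (p ^+ e)^`M(i) = p^`M(i) * p ^+ e.-1 *+ e.
Proof.
elim: e => [|e IHe]; first by rewrite expr0 mulr0n -mpolyC1 mderivC.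
rewrite exprS mderivM IHe mulrS /=; congr (_ + _).
case: e {IHe} => [|e]; first by rewrite !mulr0n mulr0.
by rewrite /= mulrnAr exprS mulrCA.
Qed.

Lemma mderiv_var (i j : 'I_n) : ('X_j : R)^`M(i) = (j == i)%:R.
Proof.
rewrite mderivX mnm1E; case: eqP => [->|_]; last by rewrite scale0r.
by rewrite scale1r -[X in (X - _)%MM]addm0 addmC addmK mpolyX0.
Qed.

(** Euler's identity divided by the degree is an explicit expression in the
    generators of the irrelevant ideal. *)
Lemma homog_irrelevant (d : nat) (p : R) :
  p \is d.+1.-homog -> irrelevant_ideal p.
Proof.
move=> hp; exists (fun i => d.+1%:R^-1 * p^`M(i)).
apply: (mulrI (natr_mpoly_unit d)); rewrite -euler_identity // mulr_sumr.
by apply: eq_bigr => i _; rewrite mulrA mulVKr ?natr_mpoly_unit // mulrC.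
Qed.

Lemma homog_irrelevant_sq (d : nat) (p : R) :
  p \is d.+2.-homog -> irrelevant_ideal_sq p.
Proof.
move=> hp.
exists (fun ij => d.+2%:R^-1 * d.+1%:R^-1 * p^`M(ij.1)^`M(ij.2)).
apply: (mulrI (natr_mpoly_unit d.+1)); rewrite -euler_identity //.
apply: (mulrI (natr_mpoly_unit d)); rewrite [LHS]mulr_sumr.
under eq_bigr => i _ do
  rewrite mulrCA -(euler_identity (mderiv_homog i hp)) mulr_sumr.
rewrite pair_bigA /= !mulr_sumr; apply: eq_bigr => -[i j] _ /=.
set D := p^`M(i)^`M(j); set a := d.+1%:R; set b := d.+2%:R.
transitivity ((a / a) * (b / b) * ('X_i * ('X_j * D))).
  by rewrite !divrr ?natr_mpoly_unit // !mul1r.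
ring.
Qed.

Lemma irrelevant_at0 (p : R) : irrelevant_ideal p -> p.@[fun _ => 0] = 0.
Proof.
case=> c ->; rewrite raddf_sum big1 //= => i _.
by rewrite mevalM mevalXU mulr0.
Qed.

End Homog.

(** * Logarithmic derivations from a resolution of the Jacobian ideal *)

Section LogDerivations.
Variables (k : fieldType) (n : nat).
Hypothesis hk : [pchar k] =i pred0.
Local Notation R := {mpoly k[n.+1]}.
Variables (f : R) (d : nat) (A : 'M[R]_(n, n.+1)).
Hypothesis f_homog : f \is d.+1.-homog.
Hypothesis f_neq0 : f != 0.

Definition gradient_col : 'cV[R]_n.+1 := \col_i f^`M(i).

Definition euler_row : 'rV[R]_n.+1 := \row_i 'X_i.

Hypothesis A_exact : forall v : 'rV_n.+1,
  v *m gradient_col = 0 <-> exists w, v = w *m A.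
Hypothesis A_inj : forall w : 'rV_n, w *m A = 0 -> w = 0.

Lemma derivation_gradient (v : 'rV_n.+1) :
  v *m gradient_col = (derivation_of v f)%:M.
Proof.
apply/matrixP=> i j; rewrite !ord1 !mxE mulr1n.
by apply: eq_bigr => l _; rewrite mxE.
Qed.

Lemma derivation_of_euler : derivation_of euler_row f = d.+1%:R * f.
Proof. by rewrite -euler_identity //; apply: eq_bigr => i _; rewrite mxE. Qed.

Definition log_basis (i : 'I_n.+1) : 'rV[R]_n.+1 :=
  if unlift ord0 i is Some j then row j A else euler_row.

Lemma log_basis_comb (c : 'rV[R]_n.+1) :
  \sum_i c 0 i *: log_basis i =
  c 0 ord0 *: euler_row + (\row_j c 0 (lift ord0 j)) *m A.
Proof.
rewrite big_ord_recl /log_basis unlift_none; congr (_ + _).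
rewrite mulmx_sum_row; apply: eq_bigr => j _.
by rewrite liftK mxE.
Qed.

(** The syzygy part is invisible to [f]: applying a combination to [f] only
    sees the Euler coordinate, which is therefore determined. *)
Lemma gradient_comb (a : R) (w : 'rV[R]_n) :
  (a *: euler_row + w *m A) *m gradient_col = (a * (d.+1%:R * f))%:M.
Proof.
rewrite mulmxDl -scalemxAl derivation_gradient derivation_of_euler.
rewrite (A_exact (w *m A)).2; last by exists w.
by rewrite addr0 scale_scalar_mx.
Qed.

Lemma log_derivation_free : free_submodule (log_derivation f).
Proof.
exists n.+1, log_basis; split=> [i|v [h vh]].
  rewrite /log_basis; case: unliftP => [j _|_]; last first.
    by exists d.+1%:R; rewrite derivation_of_euler.
  exists 0; have := derivation_gradient (row j A).
  rewrite mul0r (A_exact _).2; last by exists (delta_mx 0 j); rewrite rowE.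
  by move/matrixP/(_ 0 0); rewrite !mxE.
pose a := h / d.+1%:R.
have [w vw] : exists w, v - a *: euler_row = w *m A.
  apply/A_exact; rewrite mulmxBl -scalemxAl !derivation_gradient vh.
  rewrite derivation_of_euler scale_scalar_mx mulrA.
  by rewrite divrK ?natr_mpoly_unit // subrr.
have vE : v = a *: euler_row + w *m A by rewrite -vw addrC subrK.
pose c0 : 'rV[R]_n.+1 := \row_i if unlift ord0 i is Some j then w 0 j else a.
have c00 : c0 0 ord0 = a by rewrite mxE unlift_none.
have c0l : \row_j c0 0 (lift ord0 j) = w by apply/rowP=> j; rewrite !mxE liftK.
exists c0; split=> [|c]; first by rewrite log_basis_comb c00 c0l.
rewrite log_basis_comb => vc.
have ca : c 0 ord0 = a.
  have := congr1 (fun v => v *m gradient_col) vc; rewrite vE !gradient_comb.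
  move/matrixP/(_ 0 0); rewrite !mxE !mulr1n => /mulIf -> //.
  rewrite mulf_neq0 //; apply: contraTneq (natr_mpoly_unit n.+1 hk d) => ->.
  by rewrite unitr0.
have cw : \row_j c 0 (lift ord0 j) = w.
  apply/eqP; rewrite -subr_eq0; apply/eqP/A_inj.
  by move: vc; rewrite vE ca => /addrI wA; rewrite mulmxBl -wA subrr.
apply/rowP=> j; case: (unliftP ord0 j) => [l ->|->]; last by rewrite c00 ca.
by have /rowP/(_ l) := c0l; rewrite -cw !mxE.
Qed.

(** A constant relation is a syzygy, hence a combination of the rows of [A];
    evaluating at the origin kills the rows. *)
Lemma partials_independent_of_exact :
  (forall i j, irrelevant_ideal (A i j)) -> partials_independent f.
Proof.
move=> A_irr c c0 i.
have /A_exact[w /rowP/(_ i)] : (\row_j (c j)%:MP) *m gradient_col = 0.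
  rewrite derivation_gradient (_ : derivation_of _ f = 0) ?raddf0 // -c0.
  by apply: eq_bigr => j _; rewrite mxE mul_mpolyC.
rewrite !mxE => /(congr1 (meval (fun _ => 0))); rewrite mevalC => ->.
rewrite raddf_sum big1 //= => j _.
by rewrite mevalM (irrelevant_at0 (A_irr j i)) mulr0.
Qed.

End LogDerivations.

(** * The linear free divisor *)

Section Special.
Variables (k : fieldType) (m : nat).
Hypothesis hk : [pchar k] =i pred0.
Local Notation n := m.+3.
Local Notation R := {mpoly k[n]}.

Definition var (j : nat) : R := 'X_(inord j).
Local Notation w := (var m.+1).
Local Notation u := (var m.+2).
Local Notation f := (freepoly m var).
Local Notation g := (residual m var).

Lemma mderiv_varE j (i : 'I_n) :
  (j < n)%N -> (var j)^`M(i) = (j == i :> nat)%:R.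
Proof. by move=> jn; rewrite /var mderiv_var -val_eqE /= inordK. Qed.

Lemma mderiv_freepoly (i : 'I_n) : f^`M(i) = partial m var i.
Proof.
rewrite /freepoly mderivD mderivMn mderivM mderiv_exp.
rewrite (raddf_sum (mderiv i)) /=.
have dw : w^`M(i) = (m.+1 == i)%:R by rewrite mderiv_varE.
have du : u^`M(i) = (m.+2 == i)%:R by rewrite mderiv_varE.
have dx (j : 'I_m.+1) : (var j)^`M(i) = (j == i :> nat)%:R.
  by apply/mderiv_varE/(leq_trans (ltn_ord j))/(leq_addl 2).
under eq_bigr => j _ do rewrite !mderivM !mderiv_exp dx dw du.
rewrite dw du; have [im|] := leqP i m.
  rewrite partial_low // !gtn_eqF ?ltnS ?leqW // !(mul0r, mul0rn, mulr0, add0r).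
  transitivity (\sum_(j < m.+1) (1 *+ (j == i :> nat))
                  * (w ^+ j * u ^+ (m.+2 - j))).
    by apply: eq_bigr => j _; rewrite !mul0r !mul0rn !mulr0 !addr0 mulrA.
  rewrite (sum_delta (fun j => w ^+ j * u ^+ (m.+2 - j))) // mul1r.
  by rewrite subSn ?leqW // exprS; ring.
rewrite leq_eqVlt => /predU1P[iE|lti].
  rewrite -iE partial_w eqxx gtn_eqF // mulr0 addr0 mul1r mulrDr mulr_sumr.
  congr (_ + _); first by rewrite /=; ring.
  apply: eq_bigr => j _; rewrite ltn_eqF //.
  rewrite !mul0r !mul0rn mulr0 !addr0 add0r mul1r.
  by rewrite (subSn (leqW (leq_ord j))) exprS; ring.
have {lti} iE : i = m.+2 :> nat by apply/eqP; rewrite eqn_leq lti -ltnS ltn_ord.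
rewrite iE partial_u ltn_eqF // eqxx !mul0r mul0rn mul0r add0r mulr1.
congr (_ + _); apply: eq_bigr => j _.
rewrite ltn_eqF ?(leq_trans (ltn_ord j)) //.
rewrite !mul0r !mul0rn mulr0 addr0 mul0r add0r.
by rewrite mul1r (subSn (leqW (leq_ord j))) /=; ring.
Qed.

Definition syzygy_mx : 'M[R]_(m.+2, n) := \matrix_(p, q) syzygy m var p q.

Lemma syzygy_homog p q : syzygy m var p q \is 1.-homog.
Proof.
have H j : var j \is 1.-homog by rewrite dhomogX /= mdeg1.
rewrite /syzygy; repeat case: ifP => _;
 by rewrite ?rpredB ?rpredN ?rpredMn ?H.
Qed.

Lemma syzygy_mx_gradient : syzygy_mx *m gradient_col f = 0.
Proof.
apply/matrixP=> p j; rewrite !mxE -[RHS](syzygy_partial var (ltn_ord p)).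
by apply: eq_bigr => q _; rewrite !mxE mderiv_freepoly.
Qed.

Lemma kill_varE i j : (i < n)%N -> (j < n)%N ->
  kill_var (inord i) (var j) = if j == i then 0 else var j.
Proof. by move=> ni nj; rewrite /var kill_varX -val_eqE /= !inordK. Qed.

Lemma kill_u_pow e : (0 < e)%N -> kill_var (inord m.+2) (u ^+ e) = 0.
Proof. by case: e => // e _; rewrite rmorphXn kill_varE // eqxx expr0n. Qed.

Lemma kill_u_w e : kill_var (inord m.+2) (w ^+ e) = w ^+ e.
Proof. by rewrite rmorphXn kill_varE // ltn_eqF. Qed.

Lemma w_pow_neq0 d e : w ^+ e *+ d.+1 != 0.
Proof.
rewrite -mulr_natl mulf_neq0 ?expf_neq0 ?var_neq0 //.
by apply: contraTneq (natr_mpoly_unit n hk d) => ->; rewrite unitr0.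
Qed.

Lemma partial_unit_partP (q : 'I_n) : ~ divides u (partial_unit_part m var q).
Proof.
move/kill_var_eq0/eqP; apply/negP; rewrite /partial_unit_part.
have e0 (i : 'I_m.+1) : (0 < m.+1 - i)%N by rewrite subn_gt0.
case: ifP => _; first by rewrite kill_u_w expf_neq0 ?var_neq0.
by case: ifP => _; rewrite rmorphD rmorphMn kill_u_w rmorph_sum;
  rewrite big1 ?addr0 ?w_pow_neq0 // => i _;
  rewrite rmorphMn !rmorphM kill_u_pow // mulr0 mul0rn.
Qed.

Lemma residual_not_dvd : ~ divides u g.
Proof.
move/kill_var_eq0/eqP; apply/negP; rewrite /residual rmorphD rmorphMn kill_u_w.
rewrite rmorph_sum big1 ?addr0 ?w_pow_neq0 // => i _.
by rewrite !rmorphM kill_u_pow ?subn_gt0 // mulr0.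
Qed.

(** The only prime factor of the coefficient of [x_0] is [u], and [u] does not
    divide the rest since it does not divide the whole. *)
Lemma residual_irreducible : irreducible_elt g.
Proof.
set b := w ^+ m.+2 *+ 2 + \sum_(i < m) var i.+1 * w ^+ i.+1 * u ^+ (m - i).
have fix0 j : (0 < j)%N -> (j < n)%N -> kill_var (inord 0) (var j) = var j.
  by move=> j0 jn; rewrite kill_varE // gtn_eqF.
rewrite residual_linear -/b; apply: irreducible_linear_var.
- by rewrite expf_neq0 ?var_neq0.
- by rewrite rmorphXn fix0.
- rewrite rmorphD rmorphMn rmorphXn fix0 // rmorph_sum; congr (_ + _).
  apply: eq_bigr => i _; rewrite !rmorphM !rmorphXn !fix0 //.
  by rewrite !ltnS leqW // ltnW.
move=> c /dvd_var_exp[//|[q ->]] [r br]; case: (@residual_not_dvd).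
rewrite residual_linear -/b br exprS; exists (u ^+ m * var 0 + q * r).
by rewrite mulrDr !mulrA.
Qed.

Lemma var_irreducible (i : 'I_n) : irreducible_elt ('X_i : R).
Proof.
rewrite -['X_i]addr0 -['X_i]mul1r; apply: irreducible_linear_var.
- exact: oner_neq0.
- exact: rmorph1.
- exact: rmorph0.
by move=> c [q cq] _; apply/unitrPr; exists q.
Qed.

Lemma freepoly_reduced : reduced_elt f.
Proof.
exists 2%N, (fun i : 'I_2 => if i == ord0 then u else g); split.
- move=> i; case: eqP => _; first exact: var_irreducible.
  exact: residual_irreducible.
- move=> i j ij [c cU]; case: (eqVneq i ord0) ij => [->|i0].
    rewrite eq_sym => /negPf -> ucg; apply: residual_not_dvd.
    by exists c^-1; rewrite ucg mulrAC mulrV // mul1r.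
  case: (eqVneq j ord0) => [_ _ gcu|j0].
    by apply: residual_not_dvd; exists c; rewrite gcu mulrC.
  case/negP; rewrite -val_eqE; move: i0 j0; rewrite -!val_eqE.
  by case: i j => [[|[|i]] // ?] [[|[|j]] // ?].
by rewrite freepoly_factor !big_ord_recl big_ord0 mulr1.
Qed.

Lemma freepoly_homog : f \is n.-homog.
Proof.
have H j e : var j ^+ e \is e.-homog.
  have := dhomogMn e (_ : var j \is 1.-homog); rewrite mul1n; apply.
  by rewrite dhomogX /= mdeg1.
rewrite /freepoly rpredD ?rpredMn //.
  by have := dhomogM (H m.+1 m.+2) (H m.+2 1%N); rewrite addn1 expr1.
apply: rpred_sum => i _.
have := dhomogM (dhomogM (H i 1%N) (H m.+1 i)) (H m.+2 (m.+2 - i)%N).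
by rewrite expr1 -addnA subnKC // ltnW // leqW.
Qed.

Lemma freepoly_neq0 : f != 0.
Proof.
rewrite freepoly_factor mulf_neq0 ?var_neq0 //.
by apply/eqP=> g0; apply: residual_not_dvd; exists 0; rewrite g0 mulr0.
Qed.

Lemma syzygy_mx_diag (p : 'I_m.+2) :
  exists2 e, e \is a GRing.unit & syzygy_mx p (lift ord0 p) = e * u.
Proof.
rewrite mxE lift0 /syzygy; case: p => p /= lpm; case: (ltnP p m) => pm.
  exists (- 1); first by rewrite unitrN1.
  by rewrite gtn_eqF // eqxx mulr0n mulr1n sub0r mulN1r.
case: eqP => [->|/eqP pE].
  exists 1; first by rewrite unitr1.
  by rewrite ltnNge leqnSn gtn_eqF // eqxx mulr1n mul1r.
have -> : p = m.+1.
  by apply/eqP; rewrite eqn_leq -ltnS lpm ltn_neqAle eq_sym pE pm.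
exists (- m.+2%:R); first by rewrite unitrN natr_mpoly_unit.
by rewrite gtn_eqF // mulNr mulr_natl.
Qed.

Lemma syzygy_mx_hess (p : 'I_m.+2) (q : 'I_n) :
  (p.+1 < q)%N -> syzygy_mx p q = 0.
Proof.
rewrite mxE /syzygy; case: p q => p /= lpm [q /= lqm] pq.
case: (ltnP p m) => pm; first by rewrite !gtn_eqF ?mulr0n ?subr0 // ltnW.
case: eqP => [pE|/eqP pE].
  rewrite pE in pq.
  by rewrite ltnNge (ltnW (ltnW pq)) (gtn_eqF (ltnW pq)) (gtn_eqF pq).
have := leq_ltn_trans pq lqm; rewrite !ltnS => pm'.
by move: pE; rewrite eqn_leq pm pm'.
Qed.

Lemma syzygy_mx_exact (v : 'rV[R]_n) :
  v *m gradient_col f = 0 <-> exists r, v = r *m syzygy_mx.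
Proof.
have B_val (i : 'I_n) :
    gradient_col f i 0 = u ^+ (m.+2 - i) * partial_unit_part m var i.
  by rewrite mxE mderiv_freepoly.
exact: (staircase_exact (var_neq0 _ _) (@var_prime _ _ _) B_val
  partial_unit_partP syzygy_mx_gradient syzygy_mx_hess syzygy_mx_diag).
Qed.

Lemma syzygy_mx_inj (r : 'rV[R]_m.+2) : r *m syzygy_mx = 0 -> r = 0.
Proof.
by apply: (@staircase_inj _ u (var_neq0 _ _) _ _ syzygy_mx_hess syzygy_mx_diag).
Qed.

Lemma syzygy_mx_irrelevant p q : irrelevant_ideal (syzygy_mx p q).
Proof.
by apply: (@homog_irrelevant _ _ hk 0); rewrite mxE; apply: syzygy_homog.
Qed.

Lemma freepoly_linear_free : linear_free_divisor f.
Proof.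
split; first split.
- split.
  + exact: freepoly_neq0.
  + by exists n; apply: freepoly_homog.
  + exact: freepoly_reduced.
  + exact: (homog_irrelevant_sq hk freepoly_homog).
  + exact: (partials_independent_of_exact syzygy_mx_exact syzygy_mx_irrelevant).
- exact: (log_derivation_free hk freepoly_homog freepoly_neq0
    syzygy_mx_exact syzygy_mx_inj).
exists syzygy_mx, (gradient_col f); split=> [p q|].
  by rewrite leqnSn subSnn mxE; apply: syzygy_homog.
split=> [q j|]; first by rewrite mxE subn0; apply: mderiv_homog freepoly_homog.
split=> [x|].
  split=> [[c ->]|[v]].
    exists (\row_i c i); rewrite derivation_gradient; congr _%:M.
    by apply: eq_bigr => i _; rewrite mxE.
  rewrite derivation_gradient => /matrixP/(_ 0 0); rewrite !mxE !mulr1n => <-.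
  by exists (fun i => v 0 i).
split; first exact: syzygy_mx_exact.
by split; [exact: syzygy_mx_inj | exact: syzygy_mx_irrelevant].
Qed.

End Special.

(* Variables are indexed from 0: the variable x_i is 'X_(i-1), hence the
   exponents i and n - i.+1 below. *)
Theorem theorem2p2 (k : fieldType) (hk : [pchar k] =i pred0)
    (n : nat) (hn : (4 <= n)%N)
    (iw iu : 'I_n) (hw : iw = (n - 2)%N :> nat) (hu : iu = (n - 1)%N :> nat) :
  let w : {mpoly k[n]} := 'X_iw in
  let u : {mpoly k[n]} := 'X_iu in
  let f : {mpoly k[n]} :=
    2 * w ^+ (n - 1) * u
    + \sum_(i < n | (i < n - 2)%N) 'X_i * w ^+ i * u ^+ (n - i.+1) in
  linear_free_divisor f.
Proof.
case: n hn iw iu hw hu => [|[|[|m]]] // _ iw iu hw hu w u f.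
have wE : w = var k m m.+1.
  by congr 'X_(_); apply: val_inj; rewrite /= inordK // hw subSS subSS subn0.
have uE : u = var k m m.+2.
  by congr 'X_(_); apply: val_inj; rewrite /= inordK // hu subSS subn0.
suff -> : f = freepoly m (var k m) by apply: freepoly_linear_free.
rewrite /f wE uE /freepoly; congr (_ + _).
  by rewrite subSS subn0 -mulrA mulr_natl.
rewrite big_mkcond /= 2!big_ord_recr /= !subSS subn0 ltnn ltnNge leqnSn.
rewrite /= !addr0.
apply: eq_bigr => i _; rewrite ltn_ord subSS; congr ('X_(_) * _ * _).
by apply: val_inj; rewrite /= inordK // (leq_trans (ltn_ord i)) // (leq_addl 2).
Qed.
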